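(* Let $(X_3,T)$ be a minimal topological dynamical system with $T$ a homeomorphism, and let $X_1\xleftarrow{\pi_1}X_2\xleftarrow{\pi_2}X_3$ be factor maps where $\pi_1$ is a non-trivial proximal extension, $\pi_2$ is a non-trivial distal extension and $X_1$ is distal. If the proximal relation $P(X_3)$ is not closed, then $(X_3,T)$ is strongly $\mathcal{F}_t$-sensitive.
   Context: A topological dynamical system: compact metric space with continuous surjection; minimal means every orbit is dense. A pair $(x,y)$ is proximal if $\inf_n d(T^nx,T^ny)=0$, otherwise distal; $P(X)$ denotes the set of proximal pairs; a system is distal if all pairs of distinct points are distal. For a factor map $\phi:X\to Y$ let $R_\phi=\{(x,y):\phi(x)=\phi(y)\}$; $\phi$ is a proximal extension if $R_\phi\subset P(X)$ and a distal extension if $R_\phi\cap P(X)=\Delta_X$. Non-trivial means not a conjugacy. $(X,T)$ is strongly $\mathcal{F}_t$-sensitive if there is $\delta>0$ such that for each nonempty open $U$ there are $x,y\in U$ with $\{n\in\mathbb{Z}_+:d(T^nx,T^ny)>\delta\}$ thick (containing arbitrarily long blocks of consecutive integers). *)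

(* Defs.v *)
From HB Require Import structures.
From mathcomp Require Import all_boot all_order all_algebra.
From mathcomp Require Import all_classical all_reals all_analysis.
Set Implicit Arguments. Unset Strict Implicit. Unset Printing Implicit Defensive.
Import Order.TTheory GRing.Theory Num.Theory.
Local Open Scope classical_set_scope.
Local Open Scope ring_scope.

Section Dyn.
Context {R : realType}.

Definition tds (X : metricType R) (T : X -> X) : Prop :=
  compact [set: X] /\ continuous T /\ (forall y : X, exists x, T x = y).

Definition homeomorphism (X : metricType R) (T : X -> X) : Prop :=
  continuous T /\ exists S : X -> X, continuous S /\ cancel T S /\ cancel S T.

Definition minimal (X : metricType R) (T : X -> X) : Prop :=
  forall x : X, closure (range (fun n : nat => iter n T x)) = [set: X].

Definition proximal (X : metricType R) (T : X -> X) (x y : X) : Prop :=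
  forall e : R, 0 < e -> exists n : nat, mdist (iter n T x) (iter n T y) < e.

Definition proximal_rel (X : metricType R) (T : X -> X) : set (X * X) :=
  [set p | proximal T p.1 p.2].

Definition distal_system (X : metricType R) (T : X -> X) : Prop :=
  forall x y : X, proximal T x y -> x = y.

Definition factor_map (X Y : metricType R) (T : X -> X) (S : Y -> Y)
  (phi : X -> Y) : Prop :=
  continuous phi /\ (forall y : Y, exists x, phi x = y) /\
  (forall x : X, phi (T x) = S (phi x)).

Definition proximal_extension (X Y : metricType R) (T : X -> X) (phi : X -> Y) : Prop :=
  forall x y : X, phi x = phi y -> proximal T x y.

Definition distal_extension (X Y : metricType R) (T : X -> X) (phi : X -> Y) : Prop :=
  forall x y : X, phi x = phi y -> proximal T x y -> x = y.

(* phi is a conjugacy: a homeomorphism (the intertwining is part of factor_map) *)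
Definition conjugacy (X Y : metricType R) (phi : X -> Y) : Prop :=
  continuous phi /\
  exists psi : Y -> X, continuous psi /\ cancel phi psi /\ cancel psi phi.

Definition nontrivial (X Y : metricType R) (phi : X -> Y) : Prop := ~ conjugacy phi.

Definition thick (A : set nat) : Prop :=
  forall L : nat, exists m : nat, forall i : nat, (i < L)%N -> A (m + i)%N.

Definition strongly_Ft_sensitive (X : metricType R) (T : X -> X) : Prop :=
  exists delta : R, 0 < delta /\
    forall U : set X, open U -> U !=set0 ->
      exists x y : X, U x /\ U y /\
        thick [set n : nat | delta < mdist (iter n T x) (iter n T y)].

End Dyn.

(* Main.v *)
(** Take a pair in the closure of P(X3) that stays at distance at least eta along
    its whole orbit, and let M be the closed invariant set of all such pairs; by
    minimality M projects onto X3.  Given a nonempty open U, a finite Baire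
    argument yields k and a nonempty open W such that every x in W has a partner
    c with (x, c) in M and T^k c in U.  As M lies in the closure of P(X3), there
    is a proximal pair (x, y) with x in W and T^k y in U.  On the arbitrarily
    long blocks where the orbits of x and y are eta/2-close, the orbits of y and
    c are more than eta/2 apart. *)
Require Import Defs.
From HB Require Import structures.
From mathcomp Require Import all_boot all_order all_algebra.
From mathcomp Require Import all_classical all_reals all_analysis.
From mathcomp Require Import lra.
Import Order.TTheory GRing.Theory Num.Theory.
Local Open Scope classical_set_scope.
Local Open Scope ring_scope.

(** Induction on [s]: either [O] already lies in the head set, or removing that closed set leaves a
    nonempty open set covered by the tail. *)
Lemma finite_closed_cover_interior (X : topologicalType) (I : eqType)
    (s : seq I) (C : I -> set X) (O : set X) :
  (forall i, closed (C i)) -> open O -> O !=set0 ->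
  (forall x, O x -> exists2 i, i \in s & C i x) ->
  exists i (W : set X), [/\ open W, W !=set0 & W `<=` C i].
Proof.
move=> clC; elim: s O => [|i s IH] O oO [x Ox] cov.
  by have [] := cov x Ox.
have [sub|/existsNP[z /not_implyP[Oz nCz]]] := pselect (O `<=` C i).
  by exists i, O; split=> //; exists x.
apply: (IH (O `&` ~` C i)).
- by apply: openI => //; exact: closed_openC.
- by exists z.
- move=> y [Oy nCy]; have [j] := cov y Oy.
  by rewrite inE => /predU1P[->//|js Cj]; exists j.
Qed.

Section metric.
Context {R : realType}.
Implicit Types X Y : metricType R.

Lemma open_mdist_lt X (e : R) : open [set p : X * X | mdist p.1 p.2 < e].
Proof.
rewrite openE => -[x y] /= xye; pose r := (e - mdist x y) / 2.
have r0 : 0 < r by rewrite divr_gt0// subr_gt0.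
exists (ball x r, ball y r); first by split; exact: nbhsx_ballx.
move=> [x' y'] /=; rewrite !ballEmdist /= => -[xx' yy'].
have := metric_triangle x' x y'; have := metric_triangle x y y'.
rewrite (metric_sym x' x); rewrite /r in xx' yy'; lra.
Qed.

Lemma closed_mdist_ge X Y (f : X -> Y) (e : R) : continuous f ->
  closed [set p : X * X | e <= mdist (f p.1) (f p.2)].
Proof.
move=> fc.
have -> : [set p : X * X | e <= mdist (f p.1) (f p.2)] =
    (fun p : X * X => (f p.1, f p.2)) @^-1` ~` [set q | mdist q.1 q.2 < e].
  by apply/seteqP; split=> p /=; rewrite leNgt => /negP.
apply: preimage_closed; last by apply: open_closedC; exact: open_mdist_lt.
by move=> p _; apply: cvg_pair; apply: continuous_comp (fc _);
  [exact: cvg_fst|exact: cvg_snd].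
Qed.

Lemma compact_mdist_unif_continuous X Y (f : X -> Y) (e : R) :
  compact [set: X] -> continuous f -> 0 < e ->
  exists2 d : R, 0 < d & forall x y, mdist x y < d -> mdist (f x) (f y) < e.
Proof.
move=> /compact_near_coveringP cX fc e0.
(* Near-covering compactness makes one small [d] serve all points. Halving [r] keeps both [z] and
   its [d]-close point [y] in the ball of radius [r] about [x]. *)
have : \forall d \near (0:R)^'+, [set: X] `<=`
    [set x | forall y, mdist x y < d -> mdist (f x) (f y) < e].
  apply: cX => x _.
  have /nbhs_ballP[r /= r0 rf] : nbhs x (f @^-1` ball (f x) (e / 2)).
    by apply: fc; apply: nbhsx_ballx; rewrite divr_gt0.
  exists (ball x (r / 2), [set d | d < r / 2]).
    by split; [apply: nbhsx_ballx|apply: nbhs_right_lt]; rewrite divr_gt0.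
  move=> [z d] /= [xz dr] y zy; rewrite ballEmdist /= in xz.
  have xy := metric_triangle x z y.
  have /rf : ball x r z by rewrite ballEmdist /=; lra.
  have /rf : ball x r y by rewrite ballEmdist /=; lra.
  rewrite /= !ballEmdist /= => fy fz.
  have := metric_triangle (f z) (f x) (f y).
  rewrite (metric_sym (f z) (f x)); lra.
move=> H; have [d [d0 dP]] :=
  @filter_ex _ _ _ _ (filterI (nbhs_right_gt (0:R)) H).
by exists d => // x y; exact: dP.
Qed.

End metric.

Section dynamics.
Context {R : realType} {X : metricType R} {T : X -> X}.
Hypotheses (cX : compact [set: X]) (cT : continuous T).

Let continuous_iter n : continuous (iter n T).
Proof.
by elim: n => [|n IH] x //=; apply: continuous_comp; [exact: IH|exact: cT].
Qed.

(** The iterates of index below [L] share a modulus of uniform continuity [d], so a single time at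
    which the orbits are [d]-close starts a whole block. *)
Lemma proximal_block (x y : X) (e : R) (L : nat) : proximal T x y -> 0 < e ->
  exists m, forall i, (i < L)%N ->
    mdist (iter (m + i) T x) (iter (m + i) T y) < e.
Proof.
move=> pxy e0.
have [d d0 dP] : exists2 d : R, 0 < d & forall u v, mdist u v < d ->
    forall i, (i < L)%N -> mdist (iter i T u) (iter i T v) < e.
  elim: L => [|L [d d0 dP]]; first by exists 1.
  have [d' d'0 d'P] :=
    compact_mdist_unif_continuous _ _ _ _ cX (continuous_iter L) e0.
  exists (Num.min d d'); first by rewrite lt_min d0.
  move=> u v; rewrite lt_min => /andP[uvd uvd'] i.
  by rewrite ltnS leq_eqVlt => /predU1P[->|]; [exact: d'P|exact: dP].
have [m mxy] := pxy d d0; exists m => i iL.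
by rewrite addnC !iterD; exact: dP.
Qed.

Lemma proximal_iter n (x y : X) :
  proximal T x y -> proximal T (iter n T x) (iter n T y).
Proof.
(* A block of length [n.+1] starting at [m] contains the time [m + n], which is time [m] for the
   shifted pair. *)
move=> pxy e e0; have [m mP] := proximal_block _ _ _ n.+1 pxy e0.
by exists m; rewrite -!iterD; exact: mP.
Qed.

Lemma minimal_visit (x : X) (V : set X) : minimal T ->
  open V -> V !=set0 -> exists n, V (iter n T x).
Proof.
move=> minT oV [u Vu].
have : closure (range (fun n => iter n T x)) u by rewrite minT.
by move=> /(_ V (open_nbhs_nbhs (conj oV Vu)))[_ [[n _ <-] Vn]]; exists n.
Qed.

Let M (eta : R) := closure (proximal_rel T) `&`
  [set p : X * X | forall n, eta <= mdist (iter n T p.1) (iter n T p.2)].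

Let closed_M eta : closed (M eta).
Proof.
apply: closedI; first exact: closed_closure.
have -> : [set p : X * X | forall n, eta <= mdist (iter n T p.1) (iter n T p.2)]
    = \bigcap_n [set p | eta <= mdist (iter n T p.1) (iter n T p.2)].
  by apply/seteqP; split=> p pP n; [move=> _|]; exact: pP.
by apply: closed_bigI => n _; exact: closed_mdist_ge.
Qed.

Let M_iter eta n p : M eta p -> M eta (iter n T p.1, iter n T p.2).
Proof.
move=> [Pp dp]; split; last by move=> k /=; rewrite -!iterD; exact: dp.
have cTT : continuous (fun q : X * X => (iter n T q.1, iter n T q.2)).
  by move=> q; apply: cvg_pair; apply: continuous_comp (continuous_iter _ _);
    [exact: cvg_fst|exact: cvg_snd].
move=> B /cTT /Pp[q [Pq Bq]]; exists (iter n T q.1, iter n T q.2).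
by split=> //; exact: proximal_iter.
Qed.

(** Projections of compact sets are compact, hence closed. Taking [F] to be the whole space gives
    [M_onto]; taking preimages of [closure V] gives the closed cover [C] below. *)
Let closed_image_M eta (F : set X) : closed F ->
  closed (fst @` (M eta `&` snd @^-1` F)).
Proof.
move=> clF; apply: compact_closed; first exact: metric_hausdorff.
apply: continuous_compact.
  by apply: continuous_subspaceT => p; exact: cvg_fst.
apply: (@subclosed_compact _ _ [set: X * X]) => //; last first.
  by rewrite -setXTT; exact: compact_setX.
apply: closedI; first exact: closed_M.
by apply: preimage_closed => // p _; exact: cvg_snd.
Qed.

Let M_onto eta : minimal T -> M eta !=set0 -> forall x, exists y, M eta (x, y).
Proof.
move=> minT [p Mp] x.
have cl : closed (fst @` M eta).
  by rewrite -[M eta]setIT -(preimage_setT snd); exact: closed_image_M closedT.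
have : (fst @` M eta) x; last by move=> [[x' y] Mxy /= <-]; exists y.
(* The projection of [M eta] is closed and contains the forward orbit of [p.1], which is dense. *)
move/closure_id: cl => ->.
have : closure (range (fun n => iter n T p.1)) x by rewrite minT.
apply: closureS => _ [n _ <-].
by exists (iter n T p.1, iter n T p.2) => //; exact: M_iter.
Qed.

Theorem strongly_Ft_sensitive_of_proximal_not_closed :
  minimal T -> ~ closed (proximal_rel T) -> strongly_Ft_sensitive T.
Proof.
move=> minT nclP.
(* A limit of proximal pairs that is not proximal violates the definition at some [eta], which says
   exactly that its orbits stay [eta] apart. *)
have [eta eta0 M0] : exists2 eta : R, 0 < eta & M eta !=set0.
  move/existsNP: nclP => [p /not_implyP[clp /existsNP[eta]]].
  move=> /not_implyP[eta0 /forallNP far]; exists eta => //; exists p.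
  by split=> // n; rewrite leNgt; apply/negP/far.
exists (eta / 2); split; first by rewrite divr_gt0.
move=> U oU [u Uu].
(* Shrinking to [closure V] makes the sets [C n] closed while the partners still land in [U]. *)
have [V Vu VU] : exists2 V, nbhs u V & closure V `<=` U.
  by apply: uniform_regular; exact: open_nbhs_nbhs.
(* By compactness the visiting times to [V] are bounded uniformly, so finitely many [C n] cover the
   space. *)
have [N scov] : exists N, forall x, exists2 n, n \in iota 0 N & V^° (iter n T x).
  have : \forall N \near \oo, [set: X] `<=`
      [set x | exists2 n, n \in iota 0 N & V^° (iter n T x)].
    move/compact_near_coveringP: cX; apply=> x _.
    have [|n Vn] := minimal_visit x V^° minT (@open_interior _ V).
      by exists u.
    exists (iter n T @^-1` V^°, [set N | (n < N)%N]); last first.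
      by move=> [x' N] /= [Vx' nN]; exists n => //; rewrite mem_iota.
    split; last by exists n.+1.
    by apply: continuous_iter; apply: open_nbhs_nbhs; split=> //;
      exact: open_interior.
  by move=> /filter_ex[N NP]; exists N => x; exact: NP.
pose C n := fst @` (M eta `&` snd @^-1` (iter n T @^-1` closure V)).
have [n|x _|k [W [oW [a Wa] WC]]] :=
    @finite_closed_cover_interior _ _ (iota 0 N) C setT _ openT (ex_intro _ u I).
- apply: closed_image_M; apply: preimage_closed; last exact: closed_closure.
  by move=> x _; exact: continuous_iter.
- have [y Mxy] := M_onto eta minT M0 x.
  have [n sn /interior_subset Vn] := scov y.
  by exists n => //; exists (x, y) => //; split=> //; exact: subset_closure.
have [[a' b] [[Pab _] /VU /= Ub] /= ea] := WC a Wa; subst a'.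
(* The product of [W] and the preimage of [U] is a neighbourhood of [(a, b)], a point of the closure
   of the proximal relation. *)
have [[x y] /= [pxy [Wx Uy]]] : (proximal_rel T `&`
    (W `*` (iter k T @^-1` U))) !=set0.
  apply: Pab; exists (W, iter k T @^-1` U) => //; split=> /=.
    exact: open_nbhs_nbhs.
  by apply: continuous_iter; exact: open_nbhs_nbhs.
(* The new point [x] has its own partner [c] with the same time [k], because all of [W] lies in
   [C k]. *)
have [[x' c] [[_ far] /VU /= Uc] /= ex] := WC x Wx; subst x'.
exists (iter k T y), (iter k T c); split=> //; split=> // L.
have eta20 : 0 < eta / 2 by rewrite divr_gt0.
have [m mP] := proximal_block _ _ _ L (proximal_iter k _ _ pxy) eta20.
exists m => i iL /=; have near_xy := mP i iL.
(* At this time [x] and [c] are at least [eta] apart and [x] and [y] less than [eta / 2], so [y] and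
   [c] are more than [eta / 2] apart. *)
have := far (m + i + k)%N; rewrite /= !iterD -!iterD.
have := metric_triangle (iter (m + i) T (iter k T x))
  (iter (m + i) T (iter k T y)) (iter (m + i) T (iter k T c)).
rewrite -!iterD in near_xy *; lra.
Qed.

End dynamics.

Theorem theorem5p8 (R : realType) (X1 X2 X3 : metricType R)
  (T1 : X1 -> X1) (T2 : X2 -> X2) (T3 : X3 -> X3)
  (pi1 : X2 -> X1) (pi2 : X3 -> X2) :
  tds T1 -> tds T2 -> tds T3 ->
  homeomorphism T3 -> minimal T3 ->
  factor_map T2 T1 pi1 -> factor_map T3 T2 pi2 ->
  proximal_extension T2 pi1 -> nontrivial pi1 ->
  distal_extension T3 pi2 -> nontrivial pi2 ->
  distal_system T1 ->
  ~ closed (proximal_rel T3) ->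
  strongly_Ft_sensitive T3.
Proof.
move=> _ _ [cX3 [cT3 _]] _ minT3 _ _ _ _ _ _ _.
exact: strongly_Ft_sensitive_of_proximal_not_closed.
Qed.
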